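(* Let $p(\cdot)\in\mathcal{P}(\mathbb{R}^n)$ satisfy $p_-\in[1,\infty)$. If $\omega\in\mathcal{W}_{p(\cdot)}(\mathbb{R}^n)$, then there exists a constant $s\in(1,\infty)$ such that $\omega^{1/s}\in A_{sp(\cdot)}(\mathbb{R}^n)$.
   Context: $\mathcal{P}(\mathbb{R}^n)$ is the set of all measurable $p(\cdot):\mathbb{R}^n\to(0,\infty)$ with $0<p_-:=\operatorname{ess\,inf}p\le p_+:=\operatorname{ess\,sup}p<\infty$; $p_*:=\min\{p_-,1\}$. Variable Lebesgue spaces: for measurable $q(\cdot):\mathbb{R}^n\to(0,\infty]$ let $\varrho_{q(\cdot)}(f):=\int_{\{q<\infty\}}|f(x)|^{q(x)}\,dx+\|f\mathbf{1}_{\{q=\infty\}}\|_{L^\infty}$ and $\|f\|_{L^{q(\cdot)}(\mathbb{R}^n)}:=\inf\{\lambda\in(0,\infty):\varrho_{q(\cdot)}(f/\lambda)\le1\}$. For a measurable $v$ with $v\in(0,\infty)$ a.e., $L^{q(\cdot)}_v(\mathbb{R}^n)$ is the set of measurable $f$ with $\|f\|_{L^{q(\cdot)}_v}:=\|fv\|_{L^{q(\cdot)}}<\infty$. For $q(\cdot)\ge1$ a.e., $q'(\cdot)$ is given by $1/q(x)+1/q'(x)=1$ (with $1'=\infty$). Hardy–Littlewood maximal operator: $\mathcal{M}(f)(x):=\sup_{B\ni x}|B|^{-1}\int_B|f|$, supremum over all balls $B$ containing $x$. $A_{q(\cdot)}(\mathbb{R}^n)$ (for $q(\cdot)\in\mathcal{P}(\mathbb{R}^n)$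 with $q_-\ge1$): all measurable $v$ with $v\in(0,\infty)$ a.e. for which there is a positive constant $C$ with $\|v\mathbf{1}_B\|_{L^{q(\cdot)}}\|v^{-1}\mathbf{1}_B\|_{L^{q'(\cdot)}}\le C|B|$ for every ball $B\subset\mathbb{R}^n$. $\mathcal{W}_{p(\cdot)}(\mathbb{R}^n)$: all measurable $\omega$ with $\omega\in(0,\infty)$ a.e. such that (i) for every ball $B$, $\|\mathbf{1}_B\|_{L^{p(\cdot)/p_*}_{\omega^{p_*}}}<\infty$ and $\|\mathbf{1}_B\|_{L^{(p(\cdot)/p_* )'}_{\omega^{-p_*}}}<\infty$; (ii) there exist $\kappa,s\in(1,\infty)$ such that $\mathcal{M}$ is bounded on $L^{(sp(\cdot))'/\kappa}_{\omega^{-\kappa/s}}(\mathbb{R}^n)$ (this includes the requirement $sp(\cdot)\ge1$ a.e., so that $(sp(\cdot))'$ makes sense). *)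

(* Defs.v *)
From HB Require Import structures.
From mathcomp Require Import all_boot all_order all_algebra.
From mathcomp Require Import all_classical all_reals all_analysis.
From mathcomp Require Import measurable_realfun ess_sup_inf.

Set Implicit Arguments.
Unset Strict Implicit.
Unset Printing Implicit Defensive.

Import Order.TTheory GRing.Theory Num.Theory.
Import numFieldNormedType.Exports.

Local Open Scope classical_set_scope.
Local Open Scope ring_scope.
Local Open Scope ereal_scope.

Section borel_step.
Context (R : realType) (n : nat).
Variable mu : {measure set (n.-tuple (measurableTypeR R)) -> \bar R}.

Definition tuple_cons (xt : measurableTypeR R * n.-tuple (measurableTypeR R)) :
  n.+1.-tuple (measurableTypeR R) := [tuple of xt.1 :: xt.2].

Lemma measurable_tuple_cons : measurable_fun [set: _] tuple_cons.
Proof. exact: measurable_cons. Qed.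

HB.instance Definition _ :=
  isMeasurableFun.Build _ _ _ _ tuple_cons measurable_tuple_cons.

(* The image of (1-dim. Lebesgue) x mu under R x R^n ~ R^(n+1). *)
Definition borel_lebesgue_step : set (n.+1.-tuple (measurableTypeR R)) -> \bar R :=
  pushforward (lebesgue_measure \x^ mu) tuple_cons.

Let step0 : borel_lebesgue_step set0 = 0.
Proof. exact: measure0. Qed.

Let step_ge0 A : 0 <= borel_lebesgue_step A.
Proof. exact: (@measure_ge0 _ _ _ (pushforward _ _)). Qed.

Let step_sigma_additive : semi_sigma_additive borel_lebesgue_step.
Proof. exact: (@measure_semi_sigma_additive _ _ _ (pushforward _ _)). Qed.

HB.instance Definition _ :=
  isMeasure.Build _ _ _ borel_lebesgue_step step0 step_ge0 step_sigma_additive.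

End borel_step.

(* Lebesgue measure on the Borel sigma-algebra of R^n, the latter being the
   product sigma-algebra that the library puts on n-tuples. *)
Fixpoint borel_lebesgue (R : realType) (n : nat) :
    {measure set (n.-tuple (measurableTypeR R)) -> \bar R} :=
  match n with
  | 0%N => \d_([tuple] : 0.-tuple (measurableTypeR R))
  | k.+1 => borel_lebesgue_step (borel_lebesgue R k)
  end.

(* R^n with the sigma-algebra of all Lebesgue measurable sets (not only the
   Borel ones): the completion of the measure above. *)
Definition euclid (R : realType) (n : nat) : Type :=
  caratheodory_type (mu_ext (borel_lebesgue R n)).

HB.instance Definition _ (R : realType) (n : nat) := Measurable.on (euclid R n).

Definition leb (R : realType) (n : nat) : {measure set (euclid R n) -> \bar R} :=
  @completed_measure_extension _ _ _ (borel_lebesgue R n).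

Section variable_lebesgue.
Context (R : realType) (n : nat).
Notation T := (euclid R n).
Notation mu := (leb R n).

Definition eball (c : T) (r : R) : set T :=
  [set x | Num.sqrt (\sum_(i < n) (tnth x i - tnth c i) ^+ 2) < r]%R.

Definition balls : set (set T) :=
  [set B | exists c : T, exists2 r : R, (0 < r)%R & B = eball c r].

Definition ind (B : set T) : T -> \bar R := fun x => (\1_B x)%:E.

Section real_exponent.
Variable p : T -> R.

Definition ess_lower : \bar R := ess_inf mu (EFin \o p).
Definition ess_upper : \bar R := ess_sup mu (EFin \o p).

Definition exponent_class : Prop :=
  [/\ measurable_fun [set: T] p, forall x, (0 < p x)%R,
      0 < ess_lower & ess_upper < +oo].

(* [fine] is harmless: 0 < p_- <= p_+ < oo for p in [exponent_class]. *)
Definition p_star : R := Num.min (fine ess_lower) 1%R.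

End real_exponent.

(* For measurable q with values in ]0, oo]. Functions are extended-real valued,
   so that [maximal f] (which may take the value oo) is one of them. *)
Definition modular (q : T -> \bar R) (f : T -> \bar R) : \bar R :=
  \int[mu]_(x in [set x | q x < +oo]) (`|f x| `^ fine (q x))
  + 'N[mu]_+oo[f \_ [set x | q x = +oo]].

Definition vnorm (q : T -> \bar R) (f : T -> \bar R) : \bar R :=
  ereal_inf [set l%:E | l in
    [set l : R | (0 < l)%R /\ modular q (fun x => f x / l%:E) <= 1]].

Definition wnorm (q v f : T -> \bar R) : \bar R := vnorm q (fun x => f x * v x).

Definition Lvar (q v : T -> \bar R) : set (T -> \bar R) :=
  [set f : T -> \bar R | measurable_fun [set: T] f /\ wnorm q v f < +oo].

(* On [1, oo], [hoelder_conjugate] is the solution q' of 1/q + 1/q' = 1. *)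
Definition conj_exponent (q : T -> \bar R) : T -> \bar R :=
  fun x => hoelder_conjugate (q x).

Definition maximal (f : T -> \bar R) (x : T) : \bar R :=
  ereal_sup [set (mu B)^-1 * \int[mu]_(y in B) `|f y| |
              B in [set B | balls B /\ B x]].

Definition maximal_bounded (q v : T -> \bar R) : Prop :=
  exists2 C : R, (0 < C)%R &
    forall f, Lvar q v f -> wnorm q v (maximal f) <= C%:E * wnorm q v f.

(* Off the set where 0 < v < oo, which is null, v may be any extended real. *)
Definition weight (v : T -> \bar R) : Prop :=
  measurable_fun [set: T] v /\ {ae mu, forall x, 0 < v x < +oo}.

Definition wpow (v : T -> \bar R) (a : R) : T -> \bar R := fun x => v x `^ a.

(* Used only for q in [exponent_class] with q_- >= 1. *)
Definition Aclass (q : T -> R) : set (T -> \bar R) :=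
  [set v | weight v /\ exists2 C : R, (0 < C)%R & forall B, balls B ->
    vnorm (EFin \o q) (fun x => v x * ind B x) *
    vnorm (conj_exponent (EFin \o q)) (fun x => (v x)^-1 * ind B x)
      <= C%:E * mu B].

Definition Wclass (p : T -> R) : set (T -> \bar R) :=
  [set w | [/\ weight w,
    forall B, balls B ->
      wnorm (fun x => (p x / p_star p)%:E) (wpow w (p_star p)) (ind B) < +oo /\
      wnorm (conj_exponent (fun x => (p x / p_star p)%:E))
            (wpow w (- p_star p)) (ind B) < +oo
  & exists kappa s : R, [/\ (1 < kappa)%R, (1 < s)%R,
      {ae mu, forall x, (1 <= s * p x)%R}
    & maximal_bounded
        (fun x => conj_exponent (fun y => (s * p y)%:E) x / kappa%:E)
        (wpow w (- (kappa / s)))]]].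

End variable_lebesgue.

(* Main.v *)
(* Since p_- >= 1, p_* = 1. Put q = s p, v = w^(1/s) and let B be a ball and
   0 < lam < ||v 1_B||_q. The function u = 1_B (v/lam)^q has integral m > 1, and
   m < oo by the local integrability condition on w. The function f = lam u / m
   has integral lam, and ||f v^-1||_{q'} <= 1, i.e. f^kappa is in the unit ball
   of the space X on which the maximal operator M is bounded. By Hoelder's
   inequality M (f^kappa) >= (lam/|B|)^kappa on B, so boundedness of M bounds the
   norm of (lam/|B|)^kappa 1_B in X, that is (lam/|B|) ||v^-1 1_B||_{q'}. Now let
   lam tend to ||v 1_B||_q. *)
Require Import Defs.
From HB Require Import structures.
From mathcomp Require Import all_boot all_order all_algebra.
From mathcomp Require Import all_classical all_reals all_analysis.
From mathcomp Require Import measurable_realfun ess_sup_inf.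
From mathcomp Require Import ring lra.

Set Implicit Arguments.
Unset Strict Implicit.

Import Order.TTheory GRing.Theory Num.Theory.
Import numFieldNormedType.Exports.

Local Open Scope classical_set_scope.
Local Open Scope ring_scope.
Local Open Scope ereal_scope.

(** * Integral inequalities over a general measure *)

Section ae_integral.
Context d (T : measurableType d) (R : realType).
Variable mu : {measure set T -> \bar R}.
Import HBNNSimple.

(* No measurability is assumed of f and g: a simple function below f, set to 0
   on a null set, is below g. *)
Lemma ae_le_integral_ge0 (f g : T -> \bar R) :
  (forall x, 0 <= f x) -> (forall x, 0 <= g x) ->
  {ae mu, forall x, f x <= g x} ->
  \int[mu]_x f x <= \int[mu]_x g x.
Proof.
move=> f0 g0 [N [mN N0 fgN]].
rewrite !ge0_integralTE//; apply: ge_ereal_sup => _ [h /= hf <-].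
pose k := proj_nnsfun h (measurableC mN).
have kE x : k x = (h x * \1_(~` N) x)%R by [].
apply: (@le_trans _ _ (sintegral mu k)).
  rewrite -!integralT_nnsfun; apply: ae_ge0_le_integral => //.
  - by move=> x _; rewrite lee_fin.
  - exact/measurable_EFinP.
  - by move=> x _; rewrite lee_fin.
  - exact/measurable_EFinP.
  - exists N; split => // x hk; apply: contrapT => Nx; apply: hk => _.
    by rewrite kE indicE mem_set// mulr1.
apply: ereal_sup_ubound; exists k => // x.
rewrite kE indicE; have [Nx|Nx] := pselect (N x).
  by rewrite memNset ?mulr0//= => /(_ Nx).
rewrite mem_set// mulr1; apply: (le_trans (hf x)).
by apply: contrapT => fgx; apply: Nx; exact: fgN.
Qed.

(** Hölder's inequality for [F * \1_B] and [\1_B], with exponents [k] and [k / (k - 1)], raised to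
    the power [k]. It turns the mean of a function over a ball into a lower bound for the maximal
    function of its [k]-th power. *)
Lemma power_mean (F : T -> R) (B : set T) (k b : R) :
  measurable_fun [set: T] F -> (forall x, 0 <= F x)%R -> measurable B ->
  (1 < k)%R -> (0 < b)%R -> mu B = b%:E ->
  (b^-1%:E * \int[mu]_(x in B) (F x)%:E) `^ k <=
  b^-1%:E * \int[mu]_(x in B) ((F x) `^ k)%:E.
Proof.
move=> mF F0 mB k1 b0 muB.
have k0 : (0 < k)%R by rewrite (lt_trans _ k1).
pose l := (k / (k - 1))%R.
have l0 : (0 < l)%R by rewrite divr_gt0// subr_gt0.
have kl : (k^-1 + l^-1 = 1)%R.
  by rewrite /l invf_div; field; rewrite !gt_eqF ?subr_gt0.
pose G x := (F x * \1_B x)%R.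
have mG : measurable_fun [set: T] G by exact: measurable_funM.
have := hoelder mu mG (measurable_indic mB) k0 l0 kl.
rewrite Lnorm1.
have -> : \int[mu]_x `|(EFin \o (G \* \1_B)%R) x| = \int[mu]_(x in B) (F x)%:E.
  rewrite [RHS]integral_mkcond; apply: eq_integral => x _.
  rewrite /patch /G /= !indicE; case: ifPn => _.
    by rewrite !mulr1 ger0_norm.
  by rewrite !mulr0 normr0.
have IE : \int[mu]_(x in B) ((F x) `^ k)%:E = \int[mu]_x `|(EFin \o G) x| `^ k.
  rewrite integral_mkcond; apply: eq_integral => x _.
  rewrite /patch /G /= !indicE; case: ifPn => _.
    by rewrite !mulr1 ger0_norm.
  by rewrite !mulr0 normr0 powR0// gt_eqF.
have JE : \int[mu]_x `|(EFin \o \1_B) x| `^ l = b%:E.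
  rewrite -muB -[in RHS](setIT B) -(integral_indic mu measurableT mB).
  apply: eq_integral => x _.
  rewrite /= !indicE; case: (x \in B); first by rewrite normr1 powR1.
  by rewrite normr0 powR0//; exact: lt0r_neq0.
rewrite unlock /= in IE JE *; rewrite -IE JE => hol.
set I := \int[mu]_(x in B) (F x)%:E in hol *.
set J := \int[mu]_(x in B) ((F x) `^ k)%:E in hol *.
have I0 : 0 <= I by apply: integral_ge0 => x _; rewrite lee_fin.
have J0 : 0 <= J by apply: integral_ge0 => x _; rewrite lee_fin powR_ge0.
clearbody I J.
clear - k1 k0 l0 b0 hol I0 J0.
have b0' : 0 <= b^-1%:E by rewrite lee_fin invr_ge0 ltW.
have : I `^ k <= (J `^ k^-1 * b%:E `^ l^-1) `^ k.
  apply: gt0_ler_poweR => //; rewrite ?in_itv/= ?leey ?andbT//; first exact: ltW.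
  by rewrite mule_ge0// ?poweR_ge0// lee_fin powR_ge0.
rewrite !poweRM ?poweR_ge0// -!poweRrM mulVf ?gt_eqF// poweRe1//.
rewrite !poweR_EFin => IJ.
apply: (le_trans (lee_wpmul2l _ IJ)); first by rewrite lee_fin powR_ge0.
rewrite muleCA muleC -EFinM lee_wpmul2r// lee_fin.
rewrite -(powR_inv1 (ltW b0)) -powRrM -powRD; last by rewrite (gt_eqF b0) implybT.
suff -> : (-1 * k + l^-1 * k = -1)%R by [].
by rewrite /l; field; rewrite !gt_eqF ?subr_gt0.
Qed.

Lemma ge0_integralZl_real (f : T -> R) (c : R) :
  measurable_fun [set: T] f -> (forall x, 0 <= f x)%R -> (0 <= c)%R ->
  \int[mu]_x (c%:E * (f x)%:E) = c%:E * \int[mu]_x (f x)%:E.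
Proof.
move=> mf f0 c0; rewrite ge0_integralZl_EFin//.
  by move=> x _; rewrite lee_fin.
exact/measurable_EFinP.
Qed.

Lemma measurable_indic_expR_ln (B : set T) (f : T -> R) (g : T -> \bar R) (c : R) :
  measurable B -> measurable_fun [set: T] f -> measurable_fun [set: T] g ->
  measurable_fun [set: T] (fun x => \1_B x * expR (f x * (ln (fine (g x)) - c)))%R.
Proof.
move=> mB mf mg; apply: measurable_funM; first exact: measurable_indic.
apply: (measurableT_comp (@measurable_expR R)); apply: measurable_funM => //.
apply: measurable_funB => //; apply: (measurableT_comp (@measurable_ln R)).
by apply: (measurableT_comp _ mg); exact: fine_measurable.
Qed.

End ae_integral.

(** * Modulars with almost everywhere finite exponent, and measurability of balls *)

Section modular_integral.
Context (R : realType) (n : nat).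
Notation T := (euclid R n).
Notation mu := (leb R n).

Lemma integral_le_modular (q f u : T -> \bar R) : (forall x, 0 <= u x) ->
  {ae mu, forall x, q x < +oo /\ u x <= `|f x| `^ fine (q x)} ->
  \int[mu]_x u x <= modular q f.
Proof.
move=> u0 H; rewrite /modular -[leLHS]adde0 leeD ?Lnorm_ge0//.
rewrite [leRHS]integral_mkcond; apply: ae_le_integral_ge0 => //.
  by move=> x; rewrite /patch; case: ifPn => // _; rewrite poweR_ge0.
by apply: filterS H => x [qx ?]; rewrite /patch mem_set.
Qed.

(** Since [q] is finite almost everywhere, the essential supremum term of the modular vanishes and
    only the integral remains. *)
Lemma modular_le_integral (q f u : T -> \bar R) : (forall x, 0 <= u x) ->
  {ae mu, forall x, q x < +oo /\ `|f x| `^ fine (q x) <= u x} ->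
  modular q f <= \int[mu]_x u x.
Proof.
move=> u0 H; rewrite /modular -[leRHS]adde0 leeD//.
  rewrite [leLHS]integral_mkcond; apply: ae_le_integral_ge0 => //.
    by move=> x; rewrite /patch; case: ifPn => // _; rewrite poweR_ge0.
  by apply: filterS H => x [qx ?]; rewrite /patch mem_set.
rewrite unlock; case: ifPn => // mu0; apply/ess_supP.
apply: filterS H => x [qx _] /=; rewrite /patch memNset ?abse0//=.
by move=> qy; rewrite qy in qx.
Qed.

Lemma modular_le (q r f g : T -> \bar R) :
  {ae mu, forall x, [/\ q x < +oo, r x < +oo &
    `|f x| `^ fine (q x) <= `|g x| `^ fine (r x)]} ->
  modular q f <= modular r g.
Proof.
move=> H; apply: (@le_trans _ _ (\int[mu]_x (`|g x| `^ fine (r x)))).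
  apply: modular_le_integral => [x|]; first exact: poweR_ge0.
  by apply: filterS H => x [].
apply: integral_le_modular => [x|]; first exact: poweR_ge0.
by apply: filterS H => x [].
Qed.

Lemma vnorm_ge0 (q f : T -> \bar R) : 0 <= vnorm q f.
Proof.
by apply: le_ereal_inf_tmp => _ [l [l0 _] <-]; rewrite lee_fin ltW.
Qed.

Lemma vnorm_le (q f : T -> \bar R) (l : R) : (0 < l)%R ->
  modular q (fun x => f x / l%:E) <= 1 -> vnorm q f <= l%:E.
Proof. by move=> l0 ?; apply: ereal_inf_lbound; exists l. Qed.

Lemma vnorm_lt (q f : T -> \bar R) (a : R) : vnorm q f < a%:E ->
  exists l : R, [/\ (0 < l)%R, (l < a)%R & modular q (fun x => f x / l%:E) <= 1].
Proof. by move=> /ereal_inf_lt [_ [l [l0 ?] <-] la]; exists l. Qed.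

Lemma measurable_ball (B : set T) : balls B -> measurable B.
Proof.
(* It is enough to see that the ball is Borel: it is a sublevel set of the distance to [c]. *)
move=> [c [r r0 ->]]; apply: sub_caratheodory; apply: sub_sigma_algebra.
pose f (x : n.-tuple (measurableTypeR R)) : R :=
  Num.sqrt (\sum_(i < n) (tnth x i - tnth c i) ^+ 2)%R.
have mf : measurable_fun setT f.
  apply: measurableT_comp.
    by apply: continuous_measurable_fun; exact: sqrt_continuous.
  apply: measurable_sum => i; apply: measurable_funX.
  by apply: measurable_funB => //; exact: measurable_tnth.
have -> : eball c r = f @^-1` `]-oo, r[.
  by apply/seteqP; split => x; rewrite /= in_itv.
by rewrite -[X in measurable X]setTI; exact: mf.
Qed.

End modular_integral.

Lemma conj_exponentE (R : realType) (n : nat) (q : euclid R n -> R) x : (1 < q x)%R ->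
  conj_exponent (EFin \o q) x = (q x / (q x - 1))%:E.
Proof.
move=> q1; have q0 : (0 < q x)%R by rewrite (lt_trans _ q1).
rewrite /conj_exponent /hoelder_conjugate /= eqe gt_eqF// -EFinB inver.
by rewrite subr_eq0 gt_eqF.
Qed.

(** * The density, the test function and the dual norm *)

Section duality.
Context (R : realType) (n : nat).
Notation T := (euclid R n).
Notation mu := (leb R n).
Variables (p : T -> R) (w : T -> \bar R) (s k : R).
Hypotheses (mp : measurable_fun [set: T] p) (ww : weight w).
Hypotheses (s1 : (1 < s)%R) (k1 : (1 < k)%R).
Hypothesis p1 : {ae mu, forall x, (1 <= p x)%R}.

Let s0 : (0 < s)%R. Proof. exact: lt_trans s1. Qed.
Let k0 : (0 < k)%R. Proof. exact: lt_trans k1. Qed.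

(* [(1_B w^(1/s) / lam)^(s p)], written so as to be everywhere finite. *)
Definition density (B : set T) (lam : R) (x : T) : R :=
  (\1_B x * expR (p x * (ln (fine (w x)) - s * ln lam)))%R.

Lemma density_ge0 B lam x : (0 <= density B lam x)%R.
Proof. by rewrite mulr_ge0// expR_ge0. Qed.

Lemma measurable_density B lam : measurable B ->
  measurable_fun [set: T] (density B lam).
Proof.
by move=> mB; exact: measurable_indic_expR_ln mB mp ww.1.
Qed.

(** With [w x] written as [expR W], and scalars as exponentials of their logarithms, identities
    between powers below become rational identities between exponents, which [field] settles. *)
Lemma ae_weight_expR : {ae mu, forall x,
  [/\ (1 <= p x)%R, (1 < s * p x)%R & exists W : R, w x = (expR W)%:E]}.
Proof.
apply: filterS2 p1 ww.2 => x px /andP[wx0 wxy]; split => //.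
  by rewrite (lt_le_trans s1)// ler_pMr.
case: (w x) wx0 wxy => [r||]//; rewrite lte_fin => r0 _.
by exists (ln r); rewrite lnK.
Qed.

Let conj_sp x : (1 < s * p x)%R -> conj_exponent (fun y => (s * p y)%:E) x =
  (s * p x / (s * p x - 1))%:E.
Proof. exact: (@conj_exponentE _ _ (fun y => s * p y)%R). Qed.

(** Almost everywhere the density is the integrand of the modular at scale [lam], so [lam] is
    admissible in the infimum. The contrapositive is what gives a density of integral above 1. *)
Lemma vnorm_density B lam : (0 < lam)%R ->
  \int[mu]_x (density B lam x)%:E <= 1 ->
  vnorm (EFin \o (fun x => s * p x)%R) (fun x => wpow w s^-1 x * ind B x) <= lam%:E.
Proof.
move=> lam0 dens1; apply: vnorm_le => //; apply: le_trans dens1.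
apply: modular_le_integral => [x|]; first by rewrite lee_fin density_ge0.
apply: filterS ae_weight_expR => x [px spx [W wx]]; split; first exact: ltry.
rewrite /wpow /ind /density wx -(lnK lam0) inver gt_eqF ?expR_gt0//=.
rewrite !expRK indicE; case: (x \in B) => /=; last first.
  by rewrite mulr0 !mul0r normr0 powR0// gt_eqF// (lt_trans _ spx).
rewrite mulr1 mul1r -expRM -expRN -expRD (ger0_norm (expR_ge0 _)) -expRM lee_fin.
rewrite le_eqVlt; apply/orP; left; apply/eqP; congr expR; field.
by rewrite gt_eqF.
Qed.

Lemma density_lty B lam (P : R) : measurable B -> (0 < lam)%R ->
  {ae mu, forall x, (p x <= P)%R} ->
  wnorm (fun x => (p x / 1)%:E) (wpow w 1) (ind B) < +oo ->
  \int[mu]_x (density B lam x)%:E < +oo.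
Proof.
move=> mB lam0 pP /ereal_inf_lt [_ [l [l0 mod1] <-] _].
(* The density is [(l / lam^s)^p] times the integrand of the modular at the admissible scale [l]; as
   [0 < p <= P], that factor is at most [K]. *)
pose K := (expR (P * `|ln l - s * ln lam|))%R.
have K0 : (0 < K)%R := expR_gt0 _.
have : \int[mu]_x (K^-1%:E * (density B lam x)%:E) <= 1.
  apply: le_trans mod1; apply: integral_le_modular => [x|].
    by rewrite lee_fin mulr_ge0 ?density_ge0// invr_ge0 ltW.
  apply: filterS2 ae_weight_expR pP => x [px _ [W wx]] pxP; split; first exact: ltry.
  have p0 : (0 < p x)%R by rewrite (lt_le_trans _ px).
  rewrite /wpow /ind /density wx -[in X in _ <= X](lnK l0) inver gt_eqF ?expR_gt0//=.
  rewrite !expRK indicE; case: (x \in B) => /=; last by rewrite mul0r mule0 lee_fin powR_ge0.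
  rewrite -EFinM !mul1r -!expRM -!expRN -!expRD (ger0_norm (expR_ge0 _)) -expRM lee_fin ler_expR.
  set t := (ln l - s * ln lam)%R.
  have : (p x * t <= P * `|t|)%R.
    apply: (le_trans (ler_norm _)); rewrite normrM gtr0_norm//.
    by apply: ler_wpM2r.
  by rewrite /t; lra.
rewrite ge0_integralZl_real; last 3 first.
- exact: measurable_density.
- exact: density_ge0.
- by rewrite invr_ge0 ltW.
case: (\int[mu]_x _) => [r||]//; first by rewrite ltry.
by rewrite gt0_muley ?lte_fin ?invr_gt0.
Qed.

(* The weighted norm of [f ^ k] is the [k]-th power of the norm of [f w^(-1/s)]
   with exponent [(s p)'], and [f = lam * density / m] extremizes the pairing of
   the latter space with [1_B w^(1/s)]. *)
Lemma wnorm_test B lam m : measurable B -> (0 < lam)%R -> (1 <= m)%R ->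
  \int[mu]_x (density B lam x)%:E = m%:E ->
  wnorm (fun x => conj_exponent (fun y => (s * p y)%:E) x / k%:E)
    (wpow w (- (k / s))) (fun x => ((lam * density B lam x / m) `^ k)%:E) <= 1.
Proof.
move=> mB lam0 m1 densm; have m0 : (0 < m)%R by rewrite (lt_le_trans _ m1).
apply: vnorm_le => //.
apply: (@le_trans _ _ (\int[mu]_x (m^-1%:E * (density B lam x)%:E))).
  apply: modular_le_integral => [x|].
    by rewrite lee_fin mulr_ge0 ?density_ge0// invr_ge0 ltW.
  apply: filterS ae_weight_expR => x [px spx [W wx]].
  rewrite conj_sp// inver gt_eqF//=; split; first exact: ltry.
  rewrite /wpow inve1 mule1 wx /density/= wx/= !expRK indicE.
  have q0 : (0 < s * p x)%R by rewrite (lt_trans _ spx).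
  have q10 : (0 < s * p x - 1)%R by rewrite subr_gt0.
  case: (x \in B) => /=; last first.
    rewrite mul0r !mulr0 mul0r powR0 ?gt_eqF// mul0r normr0 powR0 ?mule0//.
    by rewrite gt_eqF// !divr_gt0.
  rewrite -EFinM mul1r -[in X in X <= _](lnK lam0) -(lnK m0) !expRK.
  rewrite -!expRN -!expRD -!expRM -expRD (ger0_norm (expR_ge0 _)) -expRM.
  rewrite lee_fin ler_expR.
  set L := ln lam; set M := ln m.
  have M0 : (0 <= M)%R by rewrite ln_ge0.
  (* The modular integrand is the density times [m^(-(s p)')]. Here [1 <= m] and [(s p)' >= 1] bound
     it by the density over [m], which has integral 1. *)
  have MM : (M <= M * (s * p x / (s * p x - 1)))%R.
    by rewrite ler_peMr// ler_pdivlMr// mul1r gerBl.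
  suff -> : (((L + p x * (W - s * L) - M) * k + W * - (k / s)) *
     (s * p x / (s * p x - 1) / k) = p x * (W - s * L) - M * (s * p x / (s * p x - 1)))%R.
    by lra.
  by field; rewrite !gt_eqF.
rewrite ge0_integralZl_real; last 3 first.
- exact: measurable_density.
- exact: density_ge0.
- by rewrite invr_ge0 ltW.
by rewrite densm -EFinM mulVf// gt_eqF.
Qed.

(** On [B], [(h w^(-k/s) / l)^((s p)'/k)] is at least [(a w^(-1/s) / l^(1/k))^((s p)')], so the
    scale [l^(1/k) / a] is admissible for the dual norm. *)
Lemma vnorm_dual (B : set T) (h : T -> \bar R) (a l : R) : (0 < a)%R -> (0 < l)%R ->
  (forall x, B x -> (a `^ k)%:E <= h x) ->
  modular (fun x => conj_exponent (fun y => (s * p y)%:E) x / k%:E)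
    (fun x => h x * wpow w (- (k / s)) x / l%:E) <= 1 ->
  vnorm (conj_exponent (EFin \o (fun x => s * p x)%R))
    (fun x => (wpow w s^-1 x)^-1 * ind B x) <= (l `^ k^-1 / a)%:E.
Proof.
move=> a0 l0 ah mod1; apply: vnorm_le; first by rewrite divr_gt0// powR_gt0.
apply: le_trans mod1; apply: modular_le.
apply: filterS ae_weight_expR => x [px spx [W wx]].
have q0 : (0 < s * p x)%R by rewrite (lt_trans _ spx).
have q10 : (0 < s * p x - 1)%R by rewrite subr_gt0.
rewrite (@conj_exponentE _ _ (fun x => s * p x)%R)// inver gt_eqF//=.
split; [exact: ltry|exact: ltry|].
set r := (s * p x / (s * p x - 1) / k)%R.
have r0 : (0 < r)%R by rewrite !divr_gt0.
rewrite /wpow wx /ind indicE; have [xB|xB] := boolP (x \in B); last first.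
  by rewrite mule0 mul0e abse0 poweR0r ?poweR_ge0// gt_eqF// divr_gt0.
have hx : (a `^ k * expR W `^ (- (k / s)) / l)%:E <=
    h x * (expR W)%:E `^ (- (k / s)) / l%:E.
  rewrite inver gt_eqF// EFinM EFinM lee_wpmul2r ?lee_fin ?invr_ge0 ?(ltW l0)//.
  by rewrite lee_wpmul2r ?lee_fin ?powR_ge0// ah//; rewrite inE in xB.
have hx0 : 0 <= (a `^ k * expR W `^ (- (k / s)) / l)%:E.
  by rewrite lee_fin !mulr_ge0 ?powR_ge0// invr_ge0 ltW.
apply: (@le_trans _ _ ((a `^ k * expR W `^ (- (k / s)) / l)%:E `^ r)); last first.
  rewrite [in leRHS]gee0_abs ?(le_trans hx0)//.
  by apply: gt0_ler_poweR; rewrite ?in_itv/= ?leey ?andbT// ?(ltW r0)// (le_trans hx0).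
rewrite mule1 inver gt_eqF ?powR_gt0 ?expR_gt0// inver gt_eqF; last first.
  by rewrite divr_gt0// powR_gt0.
rewrite -EFinM abse_EFin !poweR_EFin lee_fin -(lnK a0) -(lnK l0).
rewrite -!expRM -!expRN -!expRD -!expRN -!expRD (ger0_norm (expR_ge0 _)) -!expRM ler_expR.
rewrite le_eqVlt; apply/orP; left; apply/eqP; rewrite /r; field.
by rewrite !gt_eqF.
Qed.

End duality.

Lemma mule_le_of_lt (R : realType) (x y z : \bar R) : 0 <= x -> 0 <= y -> 0 <= z ->
  (forall t : R, (0 < t)%R -> t%:E < x -> t%:E * y <= z) -> x * y <= z.
Proof.
move=> x0 y0 z0 H.
have [->|xn0] := eqVneq x 0; first by rewrite mul0e.
have {xn0}x0 : 0 < x by rewrite lt_def xn0.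
(* This one value of [t] rules out [y = +oo] when [z] is finite. *)
have [t t0 tx] : exists2 t : R, (0 < t)%R & t%:E < x.
  case: x x0 {H} => [r||]//; last by move=> _; exists 1%R => //; rewrite ltry.
  rewrite lte_fin => r0; exists (r / 2)%R; first by rewrite divr_gt0.
  by rewrite lte_fin ltr_pdivrMr// ltr_pMr// ltr1n.
have [->|yn0] := eqVneq y 0; first by rewrite mule0.
have {yn0}y0 : 0 < y by rewrite lt_def yn0.
case: z z0 H => [c||] //; last by move=> *; rewrite leey.
rewrite lee_fin => c0 H.
case: y y0 H => [r||]//; last by move=> _ /(_ _ t0 tx); rewrite gt0_muley ?lte_fin.
rewrite lte_fin => r0 H; rewrite -lee_pdivlMr//.
have cr0 : (0 <= c / r)%R by rewrite divr_ge0// ltW.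
have {}H u : (0 < u)%R -> u%:E < x -> (u <= c / r)%R.
  by move=> u0 ux; rewrite ler_pdivlMr// -lee_fin EFinM H.
case: x H {tx} x0 => [X||] //.
  move=> H _; rewrite lee_fin; apply/unstable.ler_ltP => u uX.
  by have [u0|u0] := ltP 0%R u; [rewrite H|rewrite (le_trans u0)].
(* If [x = +oo], every positive [t] is allowed, in particular one exceeding the bound [c / r]. *)
move=> /(_ (c / r + 1)%R) H _; exfalso.
by have := H (ltr_pwDr ltr01 cr0) (ltry _); rewrite gerDl ler10.
Qed.

(** * The estimate on one ball, at a scale below the norm *)

Section ball_estimate.
Context (R : realType) (n : nat).
Notation T := (euclid R n).
Notation mu := (leb R n).
Variables (p : T -> R) (w : T -> \bar R) (s k C P : R).
Hypotheses (mp : measurable_fun [set: T] p) (ww : weight w).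
Hypotheses (s1 : (1 < s)%R) (k1 : (1 < k)%R) (C0 : (0 < C)%R).
Hypothesis p1 : {ae mu, forall x, (1 <= p x)%R}.
Hypothesis pP : {ae mu, forall x, (p x <= P)%R}.
Hypothesis M_bounded : forall f,
  Lvar (fun x => conj_exponent (fun y => (s * p y)%:E) x / k%:E) (wpow w (- (k / s))) f ->
  wnorm (fun x => conj_exponent (fun y => (s * p y)%:E) x / k%:E)
    (wpow w (- (k / s))) (maximal f) <=
  C%:E * wnorm (fun x => conj_exponent (fun y => (s * p y)%:E) x / k%:E)
    (wpow w (- (k / s))) f.

Lemma ball_estimate (B : set T) (lam : R) : balls B -> (0 < lam)%R ->
  (0 < mu B -> wnorm (fun x => (p x / 1)%:E) (wpow w 1) (ind B) < +oo) ->
  lam%:E < vnorm (EFin \o (fun x => s * p x)%R) (fun x => wpow w s^-1 x * ind B x) ->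
  lam%:E * vnorm (conj_exponent (EFin \o (fun x => s * p x)%R))
    (fun x => (wpow w s^-1 x)^-1 * ind B x) <=
  ((2 * C) `^ k^-1)%:E * mu B.
Proof.
move=> BB lam0 wB lamN; have mB := measurable_ball BB.
have k0 : (0 < k)%R by exact: lt_trans k1.
have D0 : (0 < (2 * C) `^ k^-1)%R by rewrite powR_gt0// mulr_gt0.
have dens1 : 1 < \int[mu]_x (density p w s B lam x)%:E.
  rewrite ltNge; apply/negP => /(vnorm_density ww s1 p1 lam0).
  by rewrite leNgt lamN.
(* The density vanishes off [B] but has a positive integral. Knowing this, local integrability is
   called upon only for balls of positive measure. *)
have muB0 : 0 < mu B.
  rewrite lt_def measure_ge0 andbT; apply/eqP => B0.
  suff : \int[mu]_x (density p w s B lam x)%:E <= \int[mu]_x (cst 0 x).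
    by rewrite integral0 leNgt (lt_trans _ dens1).
  apply: ae_le_integral_ge0 => [x|//|]; first by rewrite lee_fin density_ge0.
  exists B; split => // x; apply: contra_notP => Bx.
  by rewrite /= /density indicE memNset// mul0r.
case muBE : (mu B) muB0 wB => [b||] // b0 wB; last by rewrite gt0_muley ?lte_fin ?leey.
have {}wB := wB b0.
rewrite lte_fin in b0.
have := density_lty mp ww s1 p1 mB lam0 pP wB.
case densE : (\int[mu]_x _) dens1 => [m||] // m1 _; rewrite lte_fin in m1.
have m0 : (0 < m)%R by exact: lt_trans m1.
pose F x := (lam * density p w s B lam x / m)%R.
have mF : measurable_fun [set: T] F.
  rewrite (_ : F = (fun x => (lam / m) * density p w s B lam x)%R); last first.
    by apply/funext => x; rewrite /F mulrAC.
  by apply: measurable_funM; [exact: measurable_cst|exact: measurable_density].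
have F0 x : (0 <= F x)%R by rewrite /F !mulr_ge0 ?density_ge0 ?invr_ge0// ltW.
have intF : \int[mu]_(x in B) (F x)%:E = lam%:E.
  rewrite integral_mkcond.
  transitivity (\int[mu]_x ((lam / m)%:E * (density p w s B lam x)%:E)).
    apply: eq_integral => x _; rewrite /patch /F mulrAC EFinM; case: ifPn => // xB.
    by rewrite /density indicE (negbTE xB) mul0r mule0.
  rewrite ge0_integralZl_real; last 3 first.
  - exact: measurable_density.
  - exact: density_ge0.
  - by rewrite divr_ge0 ?ltW.
  by rewrite densE -EFinM divfK// gt_eqF.
pose g x : \bar R := (F x `^ k)%:E.
have g1 := wnorm_test mp ww s1 k1 p1 mB lam0 (ltW m1) densE.
have mg : measurable_fun [set: T] g.
  by apply/measurable_EFinP; exact: (measurableT_comp (measurable_powR k) mF).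
have /M_bounded Mg : Lvar (fun x => conj_exponent (fun y => (s * p y)%:E) x / k%:E)
    (wpow w (- (k / s))) g.
  by split; [exact: mg|exact: le_lt_trans g1 (ltry _)].
(* The norm is at most [C]; doubling makes the inequality strict, so that the infimum yields an
   admissible scale [l < 2 * C]. *)
have /vnorm_lt[l [l0 lC mod1]] : wnorm
    (fun x => conj_exponent (fun y => (s * p y)%:E) x / k%:E)
    (wpow w (- (k / s))) (maximal g) < (2 * C)%:E.
  apply: (le_lt_trans Mg); apply: (@le_lt_trans _ _ (C%:E * 1)).
    by rewrite lee_wpmul2l// lee_fin ltW.
  by rewrite mule1 lte_fin ltr_pMl// ltr1n.
(* [B] itself competes in the supremum, and [F] has mean [lam / b] over [B]. *)
have Mg_ge x : B x -> ((lam / b) `^ k)%:E <= maximal g x.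
  move=> Bx; apply: (@le_trans _ _ ((mu B)^-1 * \int[mu]_(y in B) `|g y|)); last first.
    by apply: ereal_sup_ubound; exists B.
  have := power_mean mF F0 mB k1 b0 muBE.
  rewrite intF -EFinM mulrC muBE inver gt_eqF// => /le_trans; apply.
  rewrite le_eqVlt; apply/orP; left; apply/eqP; congr (_ * _).
  by apply: eq_integral => y _; rewrite /g abse_EFin ger0_norm// powR_ge0.
have := vnorm_dual ww s1 k1 p1 (divr_gt0 lam0 b0) l0 Mg_ge mod1.
move=> dual; apply: (@le_trans _ _ (lam%:E * (l `^ k^-1 / (lam / b))%:E)).
  by rewrite lee_wpmul2l// lee_fin ltW.
rewrite -!EFinM lee_fin.
have -> : (lam * (l `^ k^-1 / (lam / b)) = l `^ k^-1 * b)%R by field; rewrite !gt_eqF.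
rewrite ler_wpM2r ?(ltW b0)// ge0_ler_powR ?invr_ge0 ?nnegrE ?(ltW k0) ?(ltW l0) ?(ltW lC)//.
by rewrite mulr_ge0// ltW.
Qed.

End ball_estimate.

(** * From the ball estimate to the Muckenhoupt condition *)

Unset Implicit Arguments.

Theorem proposition2p19 (R : realType) (n : nat) (n_gt0 : (0 < n)%N)
    (p : euclid R n -> R) (p_class : exponent_class p)
    (p_ge1 : 1 <= ess_lower p)
    (w : euclid R n -> \bar R) (w_W : Wclass p w) :
  exists2 s : R, (1 < s)%R & Aclass (fun x => (s * p x)%R) (wpow w s^-1%R).
Proof.
case: w_W => ww w_ball [k [s [k1 s1 _ [C C0 M_bounded]]]].
have [mp p0 _ p_fin] := p_class.
have p1 : {ae leb R n, forall x, (1 <= p x)%R}.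
  by apply: filterS (ess_infP p_ge1) => x /=; rewrite lee_fin.
exists s; first exact: s1.
split.
  split; first by apply: (measurableT_comp (measurable_poweR _)); exact: ww.1.
  apply: filterS ww.2 => x /andP[wx0 wxy].
  by rewrite /wpow poweR_gt0// poweR_lty.
exists ((2 * C) `^ k^-1)%R; first by rewrite powR_gt0// mulr_gt0.
move=> B BB; apply: mule_le_of_lt; [exact: vnorm_ge0|exact: vnorm_ge0| |].
  by rewrite mule_ge0// lee_fin powR_ge0.
move=> lam lam0 lamN.
have pP : {ae leb R n, forall x, (p x <= fine (ess_upper p))%R}.
  apply: filterS (ess_sup_ge (leb R n) (EFin \o p)) => x.
  rewrite -/(ess_upper p) /=; move: p_fin.
  by case: (ess_upper p) => [r||] //= _; rewrite lee_fin.
apply: (ball_estimate mp ww s1 k1 C0 p1 pP M_bounded BB lam0 _ lamN) => B0.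
suff ps : p_star p = 1%R by have [] := w_ball B BB; rewrite ps.
(* If [ess_lower p] were [+oo], [fine] would send it to 0 and [p_star p] would not be 1. But then
   the real-valued [p] would be infinite almost everywhere, making the whole space null, against
   [0 < mu B]. *)
rewrite /p_star; move: p_ge1; case ploE : (ess_lower p) => [r||] //=.
  by rewrite lee_fin => r1; apply/min_idPr.
move: ploE => /ess_inf_eqyP [N [mN N0 pN]] _; exfalso.
have : leb R n B <= leb R n N.
  by apply: le_measure; rewrite ?inE//; [exact: measurable_ball|move=> x _; exact: pN].
by rewrite N0 leNgt B0.
Qed.
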